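(* Let $\alpha\in\mathbb{C}\setminus\{-1,-2,\dotsc\}$ and let $z\in\mathbb{C}$ with $|z|\le 1$. Then $$\sum_{k=1}^{\infty}\binom{2k}{k}\frac{1}{\alpha+k}\Bigl(\frac{z}{4}\Bigr)^k=\begin{cases}\dfrac{1}{\alpha}\Bigl({}_2F_1\bigl(\tfrac12,\alpha;1+\alpha;z\bigr)-1\Bigr), & \alpha\ne 0,\\[2mm] 2\ln\dfrac{2}{1+\sqrt{1-z}}, & \alpha=0,\end{cases}$$ and $$\sum_{k=1}^{\infty}\binom{2k}{k}\frac{1}{\alpha+k}\Bigl(\frac{z}{4}\Bigr)^k=\frac{z}{2(1+\alpha)}\,{}_3F_2\bigl(1,\tfrac32,1+\alpha;2,2+\alpha;z\bigr).$$
   Context: The generalized hypergeometric function is ${}_pF_q(a_1,\dotsc,a_p;b_1,\dotsc,b_q;z)=\sum_{m=0}^{\infty}\frac{(a_1)_m\dotsm(a_p)_m}{(b_1)_m\dotsm(b_q)_m}\frac{z^m}{m!}$, where $(a)_0=1$ and $(a)_m=a(a+1)\dotsm(a+m-1)$ for $m\ge1$; all hypergeometric series in the claim converge for $|z|\le1$. The square root and logarithm are principal branches. *)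

(* Defs.v *)
From Stdlib Require Import Reals Factorial Lra List.
From Coquelicot Require Import Coquelicot.

(* The name C also denotes the real-valued binomial coefficient of Stdlib,
   which Coquelicot's type of complex numbers shadows. *)
Notation binom := Binomial.C.

Open Scope C_scope.

(* Total operator, meaningful when the series converges: see CSeries_correct. *)
Definition CSeries (u : nat -> C) : C :=
  (Series (fun n => Re (u n)), Series (fun n => Im (u n))).

(* The argument in (-PI, PI]; its value at 0 is irrelevant.  See Carg_bound
   and Carg_polar. *)
Definition Carg (z : C) : R :=
  if Rle_dec 0 (Im z) then acos (Re z / Cmod z) else (- acos (Re z / Cmod z))%R.

Definition Cln (z : C) : C := (ln (Cmod z), Carg z).

(* Principal branch: exp (Cln z / 2) for z <> 0, and 0 for z = 0. *)
Definition Csqrt (z : C) : C :=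
  (sqrt (Cmod z) * cos (Carg z / 2), sqrt (Cmod z) * sin (Carg z / 2))%R.

Fixpoint Cpoch (a : C) (m : nat) : C :=
  match m with
  | O => 1
  | S m' => Cpoch a m' * (a + INR m')
  end.

Definition Cprod (l : list C) : C := fold_right Cmult 1 l.

Definition pFq_term (a b : list C) (z : C) (m : nat) : C :=
  Cprod (map (fun x => Cpoch x m) a) / Cprod (map (fun x => Cpoch x m) b)
  * (z ^ m / INR (fact m)).

Definition pFq (a b : list C) (z : C) : C := CSeries (pFq_term a b z).

Lemma is_Cseries_components (u : nat -> C) (l : C) :
  is_series (V := C_NormedModule) u l ->
  is_series (fun n => Re (u n)) (Re l) /\ is_series (fun n => Im (u n)) (Im l).
Proof.
  intros H.
  assert (Hs : forall n, sum_n u n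
            = (sum_n (fun k => Re (u k)) n, sum_n (fun k => Im (u k)) n)).
  { induction n as [|n IH].
    - rewrite !sum_O. now destruct (u O).
    - rewrite !sum_Sn, IH. now destruct (u (S n)). }
  unfold is_series in *.
  split; intros P [e He].
  - destruct (H (fun w => P (fst w))) as [N HN].
    { exists e. intros y [Hy _]. now apply He. }
    exists N. intros n Hn. specialize (HN n Hn). now rewrite Hs in HN.
  - destruct (H (fun w => P (snd w))) as [N HN].
    { exists e. intros y [_ Hy]. now apply He. }
    exists N. intros n Hn. specialize (HN n Hn). now rewrite Hs in HN.
Qed.

Lemma CSeries_unique (u : nat -> C) (l : C) :
  is_series (V := C_NormedModule) u l -> CSeries u = l.
Proof.
  intros H. destruct (is_Cseries_components u l H) as [H1 H2].
  unfold CSeries. rewrite (is_series_unique _ _ H1), (is_series_unique _ _ H2).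
  now destruct l.
Qed.

Lemma CSeries_correct (u : nat -> C) :
  ex_series (V := C_NormedModule) u ->
  is_series (V := C_NormedModule) u (CSeries u).
Proof. intros [l Hl]. now rewrite (CSeries_unique u l Hl). Qed.

Lemma Re_Cmod_bound (z : C) : z <> 0 -> (-1 <= Re z / Cmod z <= 1)%R.
Proof.
  intros Hz. assert (Hp := proj1 (Cmod_gt_0 z) Hz).
  assert (Hr := re_le_Cmod z). apply Rabs_le_between in Hr.
  split; [apply Rle_div_r | apply Rle_div_l]; lra.
Qed.

Lemma Re_Im_Cmod (z : C) : (Im z * Im z = Cmod z * Cmod z - Re z * Re z)%R.
Proof. assert (H := Cmod2_alt z). simpl in H. lra. Qed.

Lemma Carg_bound (z : C) : z <> 0 -> (- PI < Carg z <= PI)%R.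
Proof.
  intros Hz. assert (Hp := proj1 (Cmod_gt_0 z) Hz).
  assert (Hb := Re_Cmod_bound z Hz).
  assert (Ha := acos_bound (Re z / Cmod z)). assert (HPI := PI_RGT_0).
  unfold Carg. destruct (Rle_dec 0 (Im z)) as [Hi|Hi]; [lra|].
  split; [|lra].
  destruct (Req_dec (acos (Re z / Cmod z)) PI) as [E|E]; [exfalso|lra].
  assert (Hc := cos_acos _ Hb). rewrite E, cos_PI in Hc.
  assert (Hre : Re z = (- Cmod z)%R).
  { replace (Re z) with (Re z / Cmod z * Cmod z)%R by (field; lra).
    rewrite <- Hc. ring. }
  assert (H := Re_Im_Cmod z). rewrite Hre in H. nra.
Qed.

Lemma Carg_polar (z : C) : z <> 0 ->
  z = (Cmod z * cos (Carg z), Cmod z * sin (Carg z))%R.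
Proof.
  intros Hz. assert (Hp := proj1 (Cmod_gt_0 z) Hz).
  assert (Hb := Re_Cmod_bound z Hz).
  assert (Hs : (Cmod z * sqrt (1 - (Re z / Cmod z)²) = Rabs (Im z))%R).
  { rewrite <- (sqrt_square (Cmod z)) at 1 by lra.
    rewrite <- sqrt_mult_alt by nra. rewrite <- sqrt_Rsqr_abs.
    f_equal. unfold Rsqr. rewrite Re_Im_Cmod. field. lra. }
  assert (Hc : (Cmod z * (Re z / Cmod z) = Re z)%R) by (field; lra).
  unfold Carg. destruct (Rle_dec 0 (Im z)) as [Hi|Hi].
  - rewrite cos_acos, sin_acos, Hs, Hc, Rabs_pos_eq by assumption.
    now destruct z.
  - rewrite cos_neg, sin_neg, cos_acos, sin_acos by assumption.
    rewrite Ropp_mult_distr_r_reverse, Hs, Hc, Rabs_left by lra.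
    rewrite Ropp_involutive. now destruct z.
Qed.

Lemma Csqrt_sqr (z : C) : Csqrt z * Csqrt z = z.
Proof.
  destruct (Ceq_dec z 0) as [->|Hz].
  - unfold Csqrt. rewrite Cmod_0, sqrt_0, !Rmult_0_l. apply Cmult_0_l.
  - rewrite (Carg_polar z Hz) at 3.
    assert (H := sqrt_sqrt _ (Cmod_ge_0 z)).
    replace (Carg z) with (2 * (Carg z / 2))%R at 1 2 by field.
    rewrite cos_2a, sin_2a. rewrite <- H at 1 2.
    unfold Csqrt, Cmult; simpl. f_equal; ring.
Qed.

(* Main.v *)
Require Import Defs.
From Stdlib Require Import Reals List Lra Lia Factorial Ranalysis5.
From Coquelicot Require Import Coquelicot.
Import ListNotations.
Open Scope C_scope.

(** Put [c_k = binom (2k) k / 4^k].  Since [c_k - c_(k+1) = c_k / (2k+2)], the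
    series of [c_k / (k+1)] telescopes, which gives absolute convergence on the
    closed disk; both hypergeometric formulas then hold term by term.

    For [alpha = 0], work along the ray [t z], [0 <= t < 1], with
    [P t = sum c_k (t z)^k] and [L t = sum_(k >= 1) c_k / k (t z)^k].
    The recurrence of [c_k] gives [(1 - t z) P' = z P / 2], hence
    [(1 - t z) P^2 = 1]; together with [t L' = P - 1] this makes
    [exp (L / 2) (1 + (1 - t z) P)] constant, equal to [2].  So
    [2 exp (- L / 2) - 1] is a square root of [1 - t z], with positive real part
    by the intermediate value theorem.  Abel's theorem carries this to [t = 1],
    where nonnegative real part identifies the principal root, and
    [|Im L| <= 2 < 2 PI] lets the principal logarithm invert [exp (L / 2)]. *)

(** * Normalised central binomial coefficients and the telescoping of their differences *)

Definition cbin (n : nat) : R := (binom (2 * n) n / 4 ^ n)%R.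

Lemma cbin_0 : cbin 0 = 1%R.
Proof. unfold cbin, Binomial.C. simpl. field. Qed.

Lemma cbin_S (n : nat) :
  cbin (S n) = (cbin n * (2 * INR n + 1) / (2 * INR n + 2))%R.
Proof.
  unfold cbin, Binomial.C.
  replace (2 * S n - S n)%nat with (S n) by lia.
  replace (2 * n - n)%nat with n by lia.
  replace (2 * S n)%nat with (S (S (2 * n))) by lia.
  rewrite !fact_simpl, !mult_INR, !S_INR, mult_INR.
  assert (Hn := pos_INR n).
  assert (Hf := INR_fact_neq_0 n).
  assert (H4 : (4 ^ n <> 0)%R) by (apply pow_nonzero; lra).
  simpl. field. repeat split; lra.
Qed.

Lemma cbin_pos (n : nat) : (0 < cbin n)%R.
Proof.
  induction n as [|n IH]; [rewrite cbin_0; lra|].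
  rewrite cbin_S. assert (Hn := pos_INR n).
  apply Rdiv_lt_0_compat; [apply Rmult_lt_0_compat|]; lra.
Qed.

Lemma cbin_diff (n : nat) :
  (cbin n - cbin (S n) = cbin n / (2 * (INR n + 1)))%R.
Proof. rewrite cbin_S. assert (Hn := pos_INR n). field. lra. Qed.

Lemma cbin_decr (n : nat) : (cbin (S n) <= cbin n)%R.
Proof.
  assert (Hn := pos_INR n). assert (Hp := cbin_pos n).
  enough (0 <= cbin n / (2 * (INR n + 1)))%R
    by (rewrite <- cbin_diff in *; lra).
  apply Rlt_le, Rdiv_lt_0_compat; lra.
Qed.

Lemma cbin_le_1 (n : nat) : (cbin n <= 1)%R.
Proof.
  induction n as [|n IH]; [rewrite cbin_0; lra|].
  assert (H := cbin_decr n). lra.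
Qed.

Lemma cbin_telescope (n : nat) :
  sum_n (fun k => cbin k - cbin (S k))%R n = (1 - cbin (S n))%R.
Proof.
  induction n as [|n IH]; [rewrite sum_O, cbin_0; lra|].
  rewrite sum_Sn, IH. unfold plus; simpl. lra.
Qed.

(** The partial sums are [1 - cbin (S n)], and [cbin] decreases to some [m >= 0]. The bound on the
    sum is kept because it later controls the imaginary part of the logarithmic series. *)
Lemma cbin_diff_summable :
  exists l, (l <= 1)%R /\ is_series (fun k => cbin k - cbin (S k))%R l.
Proof.
  destruct (ex_finite_lim_seq_decr cbin 0 cbin_decr) as [m Hm].
  { intros n. apply Rlt_le, cbin_pos. }
  exists (1 - m)%R. split.
  - enough (0 <= m)%R by lra.
    apply (is_lim_seq_le (fun _ => 0%R) cbin 0 m);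
      [intros n; apply Rlt_le, cbin_pos | apply is_lim_seq_const | exact Hm].
  - change (is_lim_seq (sum_n (fun k => cbin k - cbin (S k))%R) (1 - m)%R).
    apply (is_lim_seq_ext (fun n => 1 - cbin (S n))%R).
    { intros n. now rewrite cbin_telescope. }
    apply (is_lim_seq_minus' (fun _ => 1%R) (fun n => cbin (S n)) 1 m).
    + apply is_lim_seq_const.
    + now apply is_lim_seq_incr_1 in Hm.
Qed.

(** * Complex series by components, and convergence on the closed disk *)

Lemma is_Cseries_pair (u : nat -> C) (l : C) :
  is_series (fun n => Re (u n)) (Re l) ->
  is_series (fun n => Im (u n)) (Im l) ->
  is_series (V := C_NormedModule) u l.
Proof.
  intros H1 H2.
  assert (Hs : forall n, sum_n u n
            = (sum_n (fun k => Re (u k)) n, sum_n (fun k => Im (u k)) n)).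
  { induction n as [|n IH].
    - rewrite !sum_O. now destruct (u O).
    - rewrite !sum_Sn, IH. now destruct (u (S n)). }
  intros P [e He].
  destruct (H1 _ (locally_ball (Re l) e)) as [N1 HN1].
  destruct (H2 _ (locally_ball (Im l) e)) as [N2 HN2].
  exists (Nat.max N1 N2). intros n Hn. apply He. rewrite Hs.
  split; [apply HN1 | apply HN2]; lia.
Qed.

(** This and the next four lemmas are general facts on series, put in terms of the operations of [C]
    rather than those of an abstract normed module, so that the resulting sums are open to field
    arithmetic. *)
Lemma is_Cseries_ext (u v : nat -> C) (l : C) :
  (forall n, u n = v n) ->
  is_series (V := C_NormedModule) u l -> is_series (V := C_NormedModule) v l.
Proof. exact (is_series_ext (V := C_NormedModule) u v l). Qed.

Lemma is_Cseries_plus (u v : nat -> C) (l m : C) :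
  is_series (V := C_NormedModule) u l ->
  is_series (V := C_NormedModule) v m ->
  is_series (V := C_NormedModule) (fun n => u n + v n) (l + m).
Proof. exact (is_series_plus (V := C_NormedModule) u v l m). Qed.

Lemma is_Cseries_scal (c : C) (u : nat -> C) (l : C) :
  is_series (V := C_NormedModule) u l ->
  is_series (V := C_NormedModule) (fun n => c * u n) (c * l).
Proof. exact (is_series_scal (V := C_NormedModule) c u l). Qed.

Lemma is_Cseries_decr (u : nat -> C) (l : C) :
  is_series (V := C_NormedModule) (fun n => u (S n)) l ->
  is_series (V := C_NormedModule) u (u O + l).
Proof.
  intros H. apply (is_series_decr_1 (V := C_NormedModule)).
  replace (@plus C_NormedModule (u O + l) (@opp C_NormedModule (u O))) with l; [exact H|].
  change (l = u O + l + - u O). ring.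
Qed.

Lemma is_Cseries_incr (u : nat -> C) (l : C) :
  is_series (V := C_NormedModule) u l ->
  is_series (V := C_NormedModule) (fun n => u (S n)) (l - u O).
Proof.
  intros H. apply (is_series_incr_1 (V := C_NormedModule)).
  replace (@plus C_NormedModule (l - u O) (u O)) with l; [exact H|].
  change (l = l - u O + u O). ring.
Qed.

Lemma ex_Cseries_le (u : nat -> C) (b : nat -> R) :
  (forall n, (Cmod (u n) <= b n)%R) -> ex_series b ->
  ex_series (V := C_NormedModule) u.
Proof.
  exact (ex_series_le (V := C_CompleteNormedModule) u b).
Qed.

Lemma Cmod_pow_le_1 (z : C) (n : nat) : (Cmod z <= 1)%R -> (Cmod (z ^ n) <= 1)%R.
Proof.
  intros Hz. induction n as [|n IH]; simpl; [rewrite Cmod_1; lra|].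
  rewrite Cmod_mult. assert (H1 := Cmod_ge_0 z). assert (H2 := Cmod_ge_0 (z ^ n)). nra.
Qed.

Lemma Cplus_INR_neq_0 (alpha : C) (n : nat) :
  alpha <> - INR n -> alpha + INR n <> 0.
Proof.
  intros H E. apply H. replace alpha with (alpha + INR n - INR n) by ring.
  rewrite E. ring.
Qed.

(** As soon as [k > 2 |alpha|], the triangle inequality gives [|alpha + k + 1| >= (k + 1) / 2], so
    the term is at most [2 c_k / (k + 1) = 4 (c_k - c_(k+1))], which telescopes. The bounded weight
    [w] stands for [z^(n+1)] in one hypergeometric series and for [z^n] in the other. *)
Lemma cbin_series_cv (alpha : C) (w : nat -> C) :
  (forall n, alpha <> - INR (S n)) ->
  (forall n, (Cmod (w n) <= 1)%R) ->
  ex_series (V := C_NormedModule)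
    (fun n => cbin (S n) / (alpha + INR (S n)) * w n).
Proof.
  intros Ha Hw.
  destruct (nfloor_ex (2 * Cmod alpha)) as [N [_ HN]].
  { assert (H := Cmod_ge_0 alpha). lra. }
  apply (ex_series_incr_n (V := C_NormedModule) _ (S N)).
  apply ex_Cseries_le with
    (fun n => 4 * (cbin (S N + n) - cbin (S (S N + n))))%R.
  - intros n. set (k := (S N + n)%nat).
    assert (Hp := cbin_pos (S k)). assert (Hk := pos_INR k).
    assert (Hk1 : (INR N + 1 <= INR k)%R).
    { unfold k. rewrite plus_INR, S_INR. assert (H := pos_INR n). lra. }
    assert (Hn0 := Cplus_INR_neq_0 _ _ (Ha k)).
    assert (Hmod : ((INR k + 1) / 2 <= Cmod (alpha + INR (S k)))%R).
    { assert (H := Cmod_triangle (alpha + INR (S k)) (- alpha)).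
      replace (alpha + INR (S k) + - alpha) with (RtoC (INR (S k))) in H by ring.
      rewrite Cmod_opp in H.
      rewrite Cmod_R, Rabs_pos_eq in H by apply pos_INR.
      rewrite S_INR in H at 1. lra. }
    rewrite cbin_diff, Cmod_mult, Cmod_div, Cmod_R by exact Hn0.
    rewrite Rabs_pos_eq by lra.
    apply Rle_trans with (cbin k * / ((INR k + 1) / 2) * 1)%R;
      [| right; field; lra].
    assert (Hi : (0 < / Cmod (alpha + INR (S k)))%R)
      by (apply Rinv_0_lt_compat; lra).
    apply Rmult_le_compat; [nra | apply Cmod_ge_0 | | apply Hw].
    apply Rmult_le_compat; [lra | lra | apply cbin_decr |].
    apply Rinv_le_contravar; lra.
  - destruct cbin_diff_summable as [l [_ Hl]].
    apply (ex_series_scal (V := R_NormedModule) 4%R).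
    apply (ex_series_incr_n (fun k => cbin k - cbin (S k))%R (S N)).
    now exists l.
Qed.

(** * Pochhammer symbols and the terms of the hypergeometric series *)

Lemma Cpoch_shift (a : C) (m : nat) :
  Cpoch a m * (a + INR m) = a * Cpoch (1 + a) m.
Proof.
  induction m as [|m IH]; [simpl; ring|].
  change (Cpoch a m * (a + INR m) * (a + INR (S m))
          = a * (Cpoch (1 + a) m * (1 + a + INR m))).
  rewrite IH, S_INR, RtoC_plus. ring.
Qed.

Lemma Cpoch_neq_0 (a : C) (m : nat) :
  (forall k, a <> - INR k) -> Cpoch a m <> 0.
Proof.
  intros Ha. induction m as [|m IH]; simpl.
  - exact C1_nz.
  - apply Cmult_neq_0; [exact IH | apply Cplus_INR_neq_0, Ha].
Qed.

Lemma Cpoch_1 (m : nat) : Cpoch 1 m = INR (fact m).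
Proof.
  induction m as [|m IH]; [reflexivity|].
  change (Cpoch 1 (S m)) with (Cpoch 1 m * (1 + INR m)).
  rewrite IH, fact_simpl, mult_INR, S_INR, RtoC_mult, RtoC_plus. ring.
Qed.

Lemma Cpoch_2 (m : nat) : Cpoch 2 m = INR (fact (S m)).
Proof.
  assert (H := Cpoch_shift 1 m). replace (1 + 1) with (RtoC 2) in H.
  - rewrite Cmult_1_l in H. rewrite <- H, Cpoch_1.
    rewrite fact_simpl, mult_INR, S_INR, RtoC_mult, RtoC_plus. ring.
  - rewrite <- RtoC_plus. f_equal; lra.
Qed.

Lemma INR_fact_neq_0_C (m : nat) : RtoC (INR (fact m)) <> 0.
Proof. intros E. apply (INR_fact_neq_0 m). now apply RtoC_inj. Qed.

Lemma Cpoch_half (m : nat) : Cpoch (1 / 2) m = cbin m * INR (fact m).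
Proof.
  induction m as [|m IH].
  - rewrite cbin_0. simpl. ring.
  - change (Cpoch (1 / 2) (S m)) with (Cpoch (1 / 2) m * (1 / 2 + INR m)).
    rewrite IH, cbin_S, fact_simpl, mult_INR, S_INR.
    rewrite <- RtoC_div, <- !RtoC_plus, <- !RtoC_mult by lra.
    f_equal. assert (H := pos_INR m). field. lra.
Qed.

(** Splitting off the first factor, [(1/2)_(m+1) = (1/2) (3/2)_m], so this is [Cpoch_half] one index
    up. *)
Lemma Cpoch_three_halves (m : nat) :
  Cpoch (3 / 2) m = 2 * cbin (S m) * INR (fact (S m)).
Proof.
  assert (H := Cpoch_shift (1 / 2) m).
  replace (1 + 1 / 2) with (3 / 2) in H.
  - change (Cpoch (1 / 2) (S m) = 1 / 2 * Cpoch (3 / 2) m) in H.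
    rewrite Cpoch_half in H.
    replace (Cpoch (3 / 2) m) with (2 * (1 / 2 * Cpoch (3 / 2) m)).
    + rewrite <- H. ring.
    + field.
  - rewrite <- !RtoC_div, <- RtoC_plus by lra. f_equal. lra.
Qed.

Lemma binom_term (alpha z : C) (k : nat) :
  alpha + INR k <> 0 ->
  binom (2 * k) k * (1 / (alpha + INR k)) * (z / 4) ^ k
  = cbin k / (alpha + INR k) * z ^ k.
Proof.
  intros Ha. assert (H4 : (4 ^ k <> 0)%R) by (apply pow_nonzero; lra).
  assert (H4c : RtoC (4 ^ k) <> 0) by (intros E; now apply RtoC_inj in E).
  assert (H40 : RtoC 4 <> 0) by (intros E; apply RtoC_inj in E; lra).
  unfold Cdiv at 2. rewrite Cpow_mult_l, Cpow_inv, <- RtoC_pow by exact H40.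
  unfold cbin. rewrite RtoC_div by exact H4. field. now split.
Qed.

(** By [Cpoch_shift], [(alpha)_m / (1 + alpha)_m] collapses to [alpha / (alpha + m)], while
    [(1/2)_m / m!] is [c_m]. *)
Lemma hyp21_term (alpha z : C) (m : nat) :
  (forall n, alpha <> - INR n) ->
  pFq_term [1 / 2; alpha] [1 + alpha] z m
  = alpha * (cbin m / (alpha + INR m) * z ^ m).
Proof.
  intros Ha.
  assert (Hm := Cplus_INR_neq_0 _ _ (Ha m)).
  assert (Ha0 : alpha <> 0).
  { intros E. apply (Ha O). rewrite E. simpl. ring. }
  assert (Hs := Cpoch_shift alpha m).
  assert (H1 : Cpoch (1 + alpha) m <> 0).
  { intros E. rewrite E in Hs.
    apply (Cmult_neq_0 _ _ (Cpoch_neq_0 alpha m Ha) Hm). rewrite Hs. ring. }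
  assert (Hf := INR_fact_neq_0_C m).
  unfold pFq_term, Cprod. simpl. rewrite Cpoch_half.
  replace (Cpoch alpha m) with (alpha * Cpoch (1 + alpha) m / (alpha + INR m)).
  - field. auto.
  - rewrite <- Hs. now field.
Qed.

(** Here [(1 + alpha)_m / (2 + alpha)_m = (1 + alpha) / (1 + alpha + m)] and
    [(3/2)_m / (2)_m = 2 c_(m+1)], while [(1)_m] cancels [m!]. The index of [c] is one ahead of the
    power of [z], which explains the factor [z] in front of the final formula. *)
Lemma hyp32_term (alpha z : C) (m : nat) :
  (forall n, alpha <> - INR (S n)) ->
  pFq_term [RtoC 1; 3 / 2; 1 + alpha] [RtoC 2; 2 + alpha] z m
  = 2 * (1 + alpha) * (cbin (S m) / (alpha + INR (S m)) * z ^ m).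
Proof.
  intros Ha.
  assert (Hb : forall n, 1 + alpha <> - INR n).
  { intros n E. apply (Ha n). rewrite S_INR, RtoC_plus.
    replace alpha with (1 + alpha - 1) by ring. rewrite E. ring. }
  assert (Hm : 1 + alpha + INR m <> 0) by apply Cplus_INR_neq_0, Hb.
  assert (Hs := Cpoch_shift (1 + alpha) m).
  replace (1 + (1 + alpha)) with (2 + alpha) in Hs
    by (replace (RtoC 2) with (1 + 1) by (rewrite <- RtoC_plus; f_equal; lra); ring).
  assert (H2 : Cpoch (2 + alpha) m <> 0).
  { intros E. rewrite E in Hs.
    apply (Cmult_neq_0 _ _ (Cpoch_neq_0 _ m Hb) Hm). rewrite Hs. ring. }
  assert (Hf := INR_fact_neq_0_C m). assert (HfS := INR_fact_neq_0_C (S m)).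
  unfold pFq_term, Cprod. cbn [map fold_right].
  rewrite Cpoch_three_halves, Cpoch_1, Cpoch_2.
  replace (Cpoch (1 + alpha) m)
    with ((1 + alpha) * Cpoch (2 + alpha) m / (1 + alpha + INR m)).
  - replace (alpha + INR (S m)) with (1 + alpha + INR m)
      by (rewrite S_INR, RtoC_plus; ring).
    field. auto.
  - rewrite <- Hs. now field.
Qed.

(** * Differentiation of complex-valued functions of a real variable, by components *)

Definition is_Cderive (f : R -> C) (t : R) (l : C) : Prop :=
  is_derive (fun s => Re (f s)) t (Re l) /\ is_derive (fun s => Im (f s)) t (Im l).

Lemma is_Cderive_const (c : C) (t : R) : is_Cderive (fun _ => c) t 0.
Proof. split; apply (is_derive_const (V := R_NormedModule)). Qed.

Lemma is_Cderive_plus (f g : R -> C) (t : R) (l m : C) :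
  is_Cderive f t l -> is_Cderive g t m ->
  is_Cderive (fun s => f s + g s) t (l + m).
Proof.
  intros [Hf1 Hf2] [Hg1 Hg2].
  split; [exact (is_derive_plus _ _ _ _ _ Hf1 Hg1)
         | exact (is_derive_plus _ _ _ _ _ Hf2 Hg2)].
Qed.

Lemma is_Cderive_opp (f : R -> C) (t : R) (l : C) :
  is_Cderive f t l -> is_Cderive (fun s => - f s) t (- l).
Proof.
  intros [H1 H2].
  split; [exact (is_derive_opp _ _ _ H1) | exact (is_derive_opp _ _ _ H2)].
Qed.

Lemma is_Cderive_mult (f g : R -> C) (t : R) (l m : C) :
  is_Cderive f t l -> is_Cderive g t m ->
  is_Cderive (fun s => f s * g s) t (l * g t + f t * m).
Proof.
  intros [Hf1 Hf2] [Hg1 Hg2].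
  assert (M : forall u v du dv, is_derive u t du -> is_derive v t dv ->
    is_derive (fun s => u s * v s)%R t (du * v t + u t * dv)%R).
  { intros u v du dv Hu Hv. exact (is_derive_mult u v t du dv Hu Hv Rmult_comm). }
  split.
  - replace (Re (l * g t + f t * m))
      with (minus (Re l * Re (g t) + Re (f t) * Re m)
                  (Im l * Im (g t) + Im (f t) * Im m))%R
      by (unfold minus, plus, opp, Re, Im; simpl; ring).
    exact (is_derive_minus _ _ _ _ _ (M _ _ _ _ Hf1 Hg1) (M _ _ _ _ Hf2 Hg2)).
  - replace (Im (l * g t + f t * m))
      with (plus (Re l * Im (g t) + Re (f t) * Im m)
                 (Im l * Re (g t) + Im (f t) * Re m))%R
      by (unfold plus, Re, Im; simpl; ring).
    exact (is_derive_plus _ _ _ _ _ (M _ _ _ _ Hf1 Hg2) (M _ _ _ _ Hf2 Hg1)).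
Qed.

Lemma is_Cderive_linear (z : C) (t : R) : is_Cderive (fun s => RtoC s * z) t z.
Proof.
  destruct z as [x y].
  split; unfold Re, Im, Cmult, RtoC; simpl; auto_derive; auto; ring.
Qed.

Lemma is_Cderive_eq (f : R -> C) (t : R) (l m : C) :
  l = m -> is_Cderive f t l -> is_Cderive f t m.
Proof. now intros <-. Qed.

Lemma is_Cderive_one_minus (z : C) (t : R) : is_Cderive (fun s => 1 - RtoC s * z) t (- z).
Proof.
  apply (is_Cderive_eq _ _ (0 + - z)); [ring|].
  exact (is_Cderive_plus _ _ t _ _ (is_Cderive_const 1 t)
           (is_Cderive_opp _ t _ (is_Cderive_linear z t))).
Qed.

(** * The complex exponential, the principal logarithm and the principal square root *)

Definition Cexp (w : C) : C := (exp (Re w) * cos (Im w), exp (Re w) * sin (Im w))%R.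

Lemma Cexp_0 : Cexp 0 = 1.
Proof.
  unfold Cexp; simpl. rewrite exp_0, cos_0, sin_0. unfold RtoC. f_equal; ring.
Qed.

Lemma Cexp_plus (u v : C) : Cexp (u + v) = Cexp u * Cexp v.
Proof.
  unfold Cexp, Cmult, Re, Im; simpl. rewrite exp_plus, cos_plus, sin_plus. f_equal; ring.
Qed.

Lemma Cexp_opp (w : C) : Cexp (- w) * Cexp w = 1.
Proof. rewrite <- Cexp_plus, <- Cexp_0. f_equal. ring. Qed.

Lemma Cmod_Cexp (w : C) : Cmod (Cexp w) = exp (Re w).
Proof.
  unfold Cmod, Cexp; simpl.
  replace (_ + _)%R with (Rsqr (exp (Re w)) * (Rsqr (sin (Im w)) + Rsqr (cos (Im w))))%R
    by (unfold Rsqr; ring).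
  rewrite sin2_cos2, Rmult_1_r. apply sqrt_Rsqr, Rlt_le, exp_pos.
Qed.

Lemma Cexp_neq_0 (w : C) : Cexp w <> 0.
Proof. apply Cmod_gt_0. rewrite Cmod_Cexp. apply exp_pos. Qed.

Lemma is_Cderive_exp (f : R -> C) (t : R) (l : C) :
  is_Cderive f t l -> is_Cderive (fun s => Cexp (f s)) t (l * Cexp (f t)).
Proof.
  intros [H1 H2].
  assert (K : forall u v du dv, is_derive u t du -> is_derive v t dv ->
    is_derive (fun s => exp (u s) * cos (v s))%R t
      (du * (exp (u t) * cos (v t)) - dv * (exp (u t) * sin (v t)))%R /\
    is_derive (fun s => exp (u s) * sin (v s))%R t
      (du * (exp (u t) * sin (v t)) + dv * (exp (u t) * cos (v t)))%R).
  { clear. intros u v du dv Hu Hv.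
    assert (Du : ex_derive u t) by now exists du.
    assert (Dv : ex_derive v t) by now exists dv.
    assert (Eu : Derive (fun s : R => u s) t = du) by exact (is_derive_unique u t du Hu).
    assert (Ev : Derive (fun s : R => v s) t = dv) by exact (is_derive_unique v t dv Hv).
    split; auto_derive; auto; rewrite Eu, Ev; ring. }
  exact (K _ _ _ _ H1 H2).
Qed.

(** On [(-PI, PI]] one has [sin y >= 0] exactly when [y >= 0]. So the sign of the imaginary part, on
    which [Carg] branches, selects the case in which [acos (cos y)] gives back [y] or [- y] as
    required. *)
Lemma Cln_Cexp (w : C) : (- PI < Im w <= PI)%R -> Cln (Cexp w) = w.
Proof.
  intros Hw. unfold Cln, Carg. rewrite Cmod_Cexp, ln_exp.
  assert (He := exp_pos (Re w)).
  replace (Re (Cexp w) / exp (Re w))%R with (cos (Im w)) by (simpl; field; lra).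
  destruct w as [x y]; simpl in *. f_equal.
  destruct (Rle_dec 0 (exp x * sin y)) as [Hs|Hs].
  - apply acos_cos. split; [|lra].
    destruct (Rle_lt_dec 0 y) as [H|H]; [exact H|].
    assert (Hn := sin_gt_0 (- y)). rewrite sin_neg in Hn. nra.
  - destruct (Rle_lt_dec 0 y) as [H|H].
    + assert (Hn := sin_ge_0 y H). exfalso. apply Hs. nra.
    + rewrite <- (cos_neg y), acos_cos by lra. ring.
Qed.

(** Two square roots of [w] agree up to sign, and the principal one has nonnegative real part. If it
    were [- q], then [q] would be purely imaginary and [Re w = - (Im q)^2]; with [Re w >= 0] this
    forces [q = 0], so the two coincide anyway. *)
Lemma Csqrt_unique (w q : C) :
  q * q = w -> (0 <= Re q)%R -> (0 <= Re w)%R -> Csqrt w = q.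
Proof.
  intros Hq Rq Rw. assert (Hs := Csqrt_sqr w).
  assert (Rs : (0 <= Re (Csqrt w))%R).
  { destruct (Ceq_dec w 0) as [E|E].
    - unfold Csqrt; simpl. rewrite E, Cmod_0, sqrt_0. lra.
    - unfold Csqrt; simpl. apply Rmult_le_pos; [apply sqrt_pos|].
      destruct (Carg_bound w E). apply cos_ge_0; lra. }
  assert (Hp : (q - Csqrt w) * (q + Csqrt w) = 0).
  { replace ((q - Csqrt w) * (q + Csqrt w)) with (q * q - Csqrt w * Csqrt w) by ring.
    rewrite Hq, Hs. ring. }
  destruct (Ceq_dec (q - Csqrt w) 0) as [E|E].
  - replace q with (q - Csqrt w + Csqrt w) by ring. rewrite E. ring.
  - destruct (Ceq_dec (q + Csqrt w) 0) as [E'|E'];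
      [| now destruct (Cmult_neq_0 _ _ E E')].
    exfalso. apply E.
    assert (Es : Csqrt w = - q) by (replace (Csqrt w) with (q + Csqrt w - q) by ring;
      rewrite E'; ring).
    rewrite Es in *. destruct q as [a b]. simpl in *.
    assert (Ha : a = 0%R) by lra. rewrite <- Hq in Rw. simpl in Rw.
    assert (Hb : b = 0%R) by nra.
    rewrite Ha, Hb. unfold Cminus, Cplus, Copp, RtoC; simpl. f_equal; ring.
Qed.

(** The mean value theorem in each component. The derivative is asked to vanish only on the open
    interval, because an identity of the form [s * f' = 0] says nothing at [s = 0]. *)
Lemma is_Cderive_eq_const (f : R -> C) (b : R) : (0 <= b)%R ->
  (forall s, (0 < s < b)%R -> is_Cderive f s 0) ->
  (forall s, (0 <= s <= b)%R -> exists l, is_Cderive f s l) ->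
  f b = f 0%R.
Proof.
  intros Hb Hd Hc.
  assert (K : forall g : R -> R,
    (forall s, (0 < s < b)%R -> is_derive g s 0%R) ->
    (forall s, (0 <= s <= b)%R -> exists l : R, is_derive g s l) -> g b = g 0%R).
  { intros g Gd Gc. destruct (MVT_gen g 0%R b (fun _ => 0%R)) as [c [_ Ec]].
    - rewrite Rmin_left, Rmax_right by exact Hb. exact Gd.
    - rewrite Rmin_left, Rmax_right by exact Hb. intros s Hs.
      destruct (Gc s Hs) as [l Hl]. apply continuity_pt_filterlim.
      apply (ex_derive_continuous (V := R_NormedModule) g). now exists l.
    - lra. }
  rewrite (surjective_pairing (f b)), (surjective_pairing (f 0%R)). f_equal.
  - apply (K (fun s => Re (f s))).
    + intros s Hs. exact (proj1 (Hd s Hs)).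
    + intros s Hs. destruct (Hc s Hs) as [l Hl]. exists (Re l). exact (proj1 Hl).
  - apply (K (fun s => Im (f s))).
    + intros s Hs. exact (proj2 (Hd s Hs)).
    + intros s Hs. destruct (Hc s Hs) as [l Hl]. exists (Im l). exact (proj2 Hl).
Qed.

(** * Real power series with bounded coefficients, up to the boundary point 1 *)

Lemma CV_radius_ge_1 (a : nat -> R) :
  (forall n, (Rabs (a n) <= 1)%R) -> Rbar_le 1 (CV_radius a).
Proof.
  intros Ha. apply (proj1 (CV_radius_bounded a)). exists 1%R. intros n.
  now rewrite pow1, Rmult_1_r.
Qed.

(** If the radius of convergence exceeds 1, the sum is continuous at 1; if it equals 1, Abel's
    theorem applies, since the series converges there. *)
Lemma PSeries_left_1 (a : nat -> R) (t : nat -> R) :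
  (forall n, (Rabs (a n) <= 1)%R) -> ex_series a ->
  (forall n, (t n < 1)%R) -> is_lim_seq t 1%R ->
  is_lim_seq (fun n => PSeries a (t n)) (Series a).
Proof.
  intros Ha Hs Ht Hl.
  replace (Series a) with (PSeries a 1)
    by (apply Series_ext; intros n; rewrite pow1; ring).
  destruct (Rbar_le_lt_or_eq_dec _ _ (CV_radius_ge_1 a Ha)) as [H|H].
  - apply is_lim_seq_continuous; [|exact Hl].
    apply PSeries_continuity. now rewrite Rabs_R1.
  - assert (A := Abel a). rewrite <- H in A. simpl in A.
    apply (filterlim_comp _ _ _ t (PSeries a) eventually (at_left 1%R)).
    + intros P [e He]. apply is_lim_seq_spec in Hl. destruct (Hl e) as [N HN].
      exists N. intros n Hn. apply He; [exact (HN n Hn) | apply Ht].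
    + apply A; [lra | exact I |].
      apply ex_pseries_R. apply (ex_series_ext a); [|exact Hs].
      intros n. now rewrite pow1, Rmult_1_r.
Qed.

(** * Power series in a real variable with complex coefficients *)

Definition Cpseries (a : nat -> C) (t : R) : C :=
  (PSeries (fun k => Re (a k)) t, PSeries (fun k => Im (a k)) t).

Definition Cderive_coef (a : nat -> C) (n : nat) : C := INR (S n) * a (S n).

Lemma Im_le_Cmod (z : C) : (Rabs (Im z) <= Cmod z)%R.
Proof. eapply Rle_trans; [apply Rmax_r | apply Rmax_Cmod]. Qed.

Lemma Cpseries_0 (a : nat -> C) : Cpseries a 0 = a O.
Proof. unfold Cpseries. rewrite !PSeries_0. now destruct (a O). Qed.

Lemma is_Cseries_Cpseries (a : nat -> C) (t : R) :
  ex_pseries (fun k => Re (a k)) t -> ex_pseries (fun k => Im (a k)) t ->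
  is_series (V := C_NormedModule) (fun k => a k * RtoC t ^ k) (Cpseries a t).
Proof.
  intros H1 H2. apply is_Cseries_pair.
  - apply (is_series_ext (fun k => Re (a k) * t ^ k)%R).
    { intros k. rewrite <- RtoC_pow. unfold Re; simpl. ring. }
    exact (proj1 (is_pseries_R _ t _) (PSeries_correct _ t H1)).
  - apply (is_series_ext (fun k => Im (a k) * t ^ k)%R).
    { intros k. rewrite <- RtoC_pow. unfold Im; simpl. ring. }
    exact (proj1 (is_pseries_R _ t _) (PSeries_correct _ t H2)).
Qed.

Lemma inside_Re (a : nat -> C) (t : R) :
  (forall n, (Cmod (a n) <= 1)%R) -> (Rabs t < 1)%R ->
  Rbar_lt (Rabs t) (CV_radius (fun k => Re (a k))).
Proof.
  intros Ha Ht. apply Rbar_lt_le_trans with 1%R; [exact Ht|]. apply CV_radius_ge_1.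
  intros n. apply Rle_trans with (2 := Ha n), re_le_Cmod.
Qed.

Lemma inside_Im (a : nat -> C) (t : R) :
  (forall n, (Cmod (a n) <= 1)%R) -> (Rabs t < 1)%R ->
  Rbar_lt (Rabs t) (CV_radius (fun k => Im (a k))).
Proof.
  intros Ha Ht. apply Rbar_lt_le_trans with 1%R; [exact Ht|]. apply CV_radius_ge_1.
  intros n. apply Rle_trans with (2 := Ha n), Im_le_Cmod.
Qed.

Lemma Cpseries_correct (a : nat -> C) (t : R) :
  (forall n, (Cmod (a n) <= 1)%R) -> (Rabs t < 1)%R ->
  is_series (V := C_NormedModule) (fun k => a k * RtoC t ^ k) (Cpseries a t).
Proof.
  intros Ha Ht.
  apply is_Cseries_Cpseries; apply CV_radius_inside;
    [now apply inside_Re | now apply inside_Im].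
Qed.

Lemma Cderive_coef_Re (a : nat -> C) (n : nat) :
  PS_derive (fun k => Re (a k)) n = Re (Cderive_coef a n).
Proof. unfold PS_derive, Cderive_coef, Re; simpl. ring. Qed.

Lemma Cderive_coef_Im (a : nat -> C) (n : nat) :
  PS_derive (fun k => Im (a k)) n = Im (Cderive_coef a n).
Proof. unfold PS_derive, Cderive_coef, Im; simpl. ring. Qed.

Lemma Cpseries_derive_correct (a : nat -> C) (t : R) :
  (forall n, (Cmod (a n) <= 1)%R) -> (Rabs t < 1)%R ->
  is_series (V := C_NormedModule)
    (fun k => Cderive_coef a k * RtoC t ^ k) (Cpseries (Cderive_coef a) t).
Proof.
  intros Ha Ht. apply is_Cseries_Cpseries.
  - apply (ex_pseries_ext _ _ t (Cderive_coef_Re a)).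
    now apply ex_pseries_derive, inside_Re.
  - apply (ex_pseries_ext _ _ t (Cderive_coef_Im a)).
    now apply ex_pseries_derive, inside_Im.
Qed.

Lemma is_Cderive_Cpseries (a : nat -> C) (t : R) :
  (forall n, (Cmod (a n) <= 1)%R) -> (Rabs t < 1)%R ->
  is_Cderive (Cpseries a) t (Cpseries (Cderive_coef a) t).
Proof.
  intros Ha Ht. split; simpl.
  - evar_last; [now apply is_derive_PSeries, inside_Re | apply PSeries_ext, Cderive_coef_Re].
  - evar_last; [now apply is_derive_PSeries, inside_Im | apply PSeries_ext, Cderive_coef_Im].
Qed.

(** * The binomial and logarithmic series along the ray [t z] *)

Definition bin_coef (z : C) (n : nat) : C := cbin n * z ^ n.

Definition log_coef (z : C) (n : nat) : C :=
  match n with O => 0 | S m => cbin n / INR n * z ^ n end.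

Lemma bin_coef_bound (z : C) (n : nat) : (Cmod z <= 1)%R -> (Cmod (bin_coef z n) <= 1)%R.
Proof.
  intros Hz. unfold bin_coef. rewrite Cmod_mult, Cmod_R.
  assert (Hp := cbin_pos n). rewrite Rabs_pos_eq by lra.
  assert (H1 := cbin_le_1 n). assert (H2 := Cmod_pow_le_1 z n Hz).
  assert (H3 := Cmod_ge_0 (z ^ n)). nra.
Qed.

Lemma INR_S_neq_0_C (n : nat) : RtoC (INR (S n)) <> 0.
Proof. intros E. apply RtoC_inj in E. now apply (not_0_INR (S n)). Qed.

Lemma log_coef_derive (z : C) (n : nat) :
  Cderive_coef (log_coef z) n = bin_coef z (S n).
Proof.
  unfold Cderive_coef, log_coef, bin_coef. field. apply INR_S_neq_0_C.
Qed.

(** Since [c] decreases, [c_(n+1) / (n+1) <= c_n / (n+1)], and the latter is twice the telescoping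
    difference. *)
Lemma log_coef_S_bound (z : C) (n : nat) : (Cmod z <= 1)%R ->
  (Cmod (log_coef z (S n)) <= 2 * (cbin n - cbin (S n)))%R.
Proof.
  intros Hz. unfold log_coef.
  rewrite Cmod_mult, Cmod_div, !Cmod_R by apply INR_S_neq_0_C.
  assert (Hp := cbin_pos (S n)). assert (Hn := pos_INR n).
  rewrite !Rabs_pos_eq, cbin_diff, S_INR by (try apply pos_INR; lra).
  apply Rle_trans with (cbin n * / (INR n + 1) * 1)%R; [|right; field; lra].
  assert (Hi : (0 < / (INR n + 1))%R) by (apply Rinv_0_lt_compat; lra).
  assert (Hd := cbin_decr n).
  apply Rmult_le_compat; [unfold Rdiv; nra | apply Cmod_ge_0 | unfold Rdiv; nra |].
  now apply Cmod_pow_le_1.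
Qed.

Lemma log_coef_bound (z : C) (n : nat) : (Cmod z <= 1)%R -> (Cmod (log_coef z n) <= 1)%R.
Proof.
  intros Hz. destruct n as [|n]; [simpl; rewrite Cmod_0; lra|].
  eapply Rle_trans; [now apply log_coef_S_bound|].
  rewrite cbin_diff. assert (H1 := cbin_le_1 n). assert (Hn := pos_INR n).
  replace (2 * (cbin n / (2 * (INR n + 1))))%R with (cbin n / (INR n + 1))%R
    by (field; lra).
  apply Rle_div_l; lra.
Qed.

Lemma log_coef_cv (z : C) : (Cmod z <= 1)%R ->
  ex_series (fun n => Cmod (log_coef z n)).
Proof.
  intros Hz. apply (ex_series_incr_1 (V := R_NormedModule)).
  apply (ex_series_le (V := R_CompleteNormedModule) _
    (fun n => 2 * (cbin n - cbin (S n)))%R).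
  - intros n. unfold norm; simpl. unfold abs; simpl.
    rewrite Rabs_pos_eq by apply Cmod_ge_0. now apply log_coef_S_bound.
  - destruct cbin_diff_summable as [l [_ Hl]].
    apply (ex_series_scal (V := R_NormedModule) 2%R). now exists l.
Qed.

(** The moduli are dominated by twice the telescoping series, whose sum is at most 1. The bound
    keeps half of the series inside the strip where the principal logarithm inverts [Cexp]. *)
Lemma log_series_Im_bound (z : C) : (Cmod z <= 1)%R ->
  (Rabs (Im (CSeries (log_coef z))) <= 2)%R.
Proof.
  intros Hz. assert (Hc := log_coef_cv z Hz). simpl.
  destruct cbin_diff_summable as [l [Hl1 Hl]].
  apply Rle_trans with (Series (fun n => Cmod (log_coef z n))).
  - eapply Rle_trans; [apply Series_Rabs | apply Series_le].
    + apply (ex_series_le (V := R_CompleteNormedModule) _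
        (fun n => Cmod (log_coef z n))); [|exact Hc].
      intros n. unfold norm; simpl. unfold abs; simpl.
      rewrite Rabs_Rabsolu. apply Im_le_Cmod.
    + intros n. split; [apply Rabs_pos | apply Im_le_Cmod].
    + exact Hc.
  - rewrite Series_incr_1 by exact Hc. simpl (log_coef z 0). rewrite Cmod_0.
    apply Rle_trans with (Series (fun n => 2 * (cbin n - cbin (S n))))%R.
    + rewrite Rplus_0_l. apply Series_le.
      * intros n. split; [apply Cmod_ge_0 | now apply log_coef_S_bound].
      * apply (ex_series_scal (V := R_NormedModule) 2%R). now exists l.
    + rewrite Series_scal_l, (is_series_unique _ _ Hl). lra.
Qed.

(** * Differential equations along the ray and the identities they integrate to *)

Lemma bin_coef_rec (z : C) (k : nat) :
  Cderive_coef (bin_coef z) k = z * (INR k * bin_coef z k) + z / 2 * bin_coef z k.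
Proof.
  unfold Cderive_coef, bin_coef. change (z ^ S k) with (z * z ^ k).
  replace (RtoC (cbin (S k))) with (RtoC (cbin k) * (2 * INR k + 1) / (2 * INR (S k))).
  - field. apply INR_S_neq_0_C.
  - assert (H := pos_INR k). rewrite cbin_S, S_INR.
    rewrite <- !RtoC_mult, <- RtoC_plus, <- RtoC_mult, <- RtoC_div by lra.
    f_equal. field. lra.
Qed.

(** Multiplying [bin_coef_rec] by [t^k] and summing gives [P' = z (t P') + (z / 2) P]. *)
Lemma bin_series_ode (z : C) (t : R) : (Cmod z <= 1)%R -> (Rabs t < 1)%R ->
  (1 - t * z) * Cpseries (Cderive_coef (bin_coef z)) t
  = z / 2 * Cpseries (bin_coef z) t.
Proof.
  intros Hz Ht.
  assert (Hb := fun n => bin_coef_bound z n Hz).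
  set (P := Cpseries (bin_coef z) t). set (D := Cpseries (Cderive_coef (bin_coef z)) t).
  assert (HP := Cpseries_correct _ _ Hb Ht : is_series (V := C_NormedModule) _ P).
  assert (HD := Cpseries_derive_correct _ _ Hb Ht : is_series (V := C_NormedModule) _ D).
  (* Multiplication by [t] moves the derived series up by one index; the new term at index 0 carries
     the factor [INR 0] and vanishes. *)
  assert (HtD : is_series (V := C_NormedModule)
            (fun k => INR k * bin_coef z k * RtoC t ^ k) (t * D)).
  { replace (RtoC t * D) with (INR 0 * bin_coef z 0 * RtoC t ^ 0 + t * D)
      by (simpl; ring).
    apply (is_Cseries_decr (fun k => INR k * bin_coef z k * RtoC t ^ k)).
    eapply is_Cseries_ext; [|apply (is_Cseries_scal t _ _ HD)].
    intros k. unfold Cderive_coef.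
    change (RtoC t ^ S k) with (RtoC t * RtoC t ^ k). ring. }
  assert (HR := is_Cseries_plus _ _ _ _ (is_Cseries_scal z _ _ HtD)
                  (is_Cseries_scal (z / 2) _ _ HP)).
  enough (E : D = z * (t * D) + z / 2 * P).
  { replace ((1 - t * z) * D) with (D - z * (t * D)) by ring.
    rewrite E at 1. ring. }
  rewrite <- (CSeries_unique _ _ HD) at 1. apply CSeries_unique.
  eapply is_Cseries_ext; [|exact HR].
  intros k. cbv beta. rewrite bin_coef_rec. ring.
Qed.

(** Since [k (c_k / k) = c_k], both sides are the binomial series without its constant term. *)
Lemma log_series_derive (z : C) (t : R) : (Cmod z <= 1)%R -> (Rabs t < 1)%R ->
  t * Cpseries (Cderive_coef (log_coef z)) t = Cpseries (bin_coef z) t - 1.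
Proof.
  intros Hz Ht.
  assert (HP := Cpseries_correct _ _ (fun n => bin_coef_bound z n Hz) Ht).
  assert (HD := Cpseries_derive_correct _ _ (fun n => log_coef_bound z n Hz) Ht).
  apply is_Cseries_incr in HP. apply (is_Cseries_scal t) in HD.
  replace (Cpseries (bin_coef z) t - 1)
    with (Cpseries (bin_coef z) t - bin_coef z 0 * RtoC t ^ 0)
    by (unfold bin_coef; rewrite cbin_0; simpl; ring).
  rewrite <- (CSeries_unique _ _ HP). symmetry. apply CSeries_unique.
  eapply is_Cseries_ext; [|exact HD].
  intros k. cbv beta. rewrite log_coef_derive.
  change (RtoC t ^ S k) with (RtoC t * RtoC t ^ k). ring.
Qed.

(** The derivative is [- z P^2 + 2 P (1 - t z) P'], which the differential equation reduces to 0,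
    and the value at [t = 0] is [c_0^2 = 1]. *)
Lemma bin_series_sqr (z : C) (t : R) : (Cmod z <= 1)%R -> (0 <= t < 1)%R ->
  (1 - t * z) * (Cpseries (bin_coef z) t * Cpseries (bin_coef z) t) = 1.
Proof.
  intros Hz Ht.
  assert (Hb := fun n => bin_coef_bound z n Hz).
  set (P := Cpseries (bin_coef z)).
  assert (HD : forall s, (0 <= s <= t)%R ->
    is_Cderive (fun s => (1 - RtoC s * z) * (P s * P s)) s 0).
  { intros s Hs. assert (As : (Rabs s < 1)%R) by (apply Rabs_def1; lra).
    assert (Dp := is_Cderive_Cpseries _ _ Hb As).
    assert (Ode := bin_series_ode z s Hz As).
    eapply is_Cderive_eq;
      [|exact (is_Cderive_mult _ _ s _ _ (is_Cderive_one_minus z s)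
         (is_Cderive_mult _ _ s _ _ Dp Dp))].
    fold P in Ode |- *.
    set (D := Cpseries (Cderive_coef (bin_coef z)) s) in *.
    transitivity (- z * (P s * P s) + 2 * P s * ((1 - s * z) * D)); [ring|].
    rewrite Ode. field. }
  rewrite (is_Cderive_eq_const (fun s => (1 - RtoC s * z) * (P s * P s)) t).
  - unfold P. rewrite Cpseries_0. unfold bin_coef. rewrite cbin_0. simpl. ring.
  - lra.
  - intros s Hs. apply HD. lra.
  - intros s Hs. exists 0. now apply HD.
Qed.

(** By [bin_series_sqr], [(1 - t z) P] is a square root of [1 - t z]. Hence this is the
    exponentiated form of the logarithmic formula on the ray, with the choice of the root still to
    be identified. *)
Lemma log_series_exp (z : C) (t : R) : (Cmod z <= 1)%R -> (0 <= t < 1)%R ->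
  Cexp (1 / 2 * Cpseries (log_coef z) t)
  * (1 + (1 - t * z) * Cpseries (bin_coef z) t) = 2.
Proof.
  intros Hz Ht.
  assert (Hb := fun n => bin_coef_bound z n Hz).
  assert (Hl := fun n => log_coef_bound z n Hz).
  set (P := Cpseries (bin_coef z)). set (L := Cpseries (log_coef z)).
  set (f := fun s : R => Cexp (1 / 2 * L s) * (1 + (1 - RtoC s * z) * P s)).
  (* [L'] is only known through [s * L' = P - 1], so the derivative [d] of [f]
     is shown to vanish after multiplication by [s]. *)
  assert (HD : forall s, (0 <= s <= t)%R -> exists d, is_Cderive f s d /\ s * d = 0).
  { intros s Hs. assert (As : (Rabs s < 1)%R) by (apply Rabs_def1; lra).
    assert (Dp := is_Cderive_Cpseries _ _ Hb As).
    assert (Dl := is_Cderive_Cpseries _ _ Hl As).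
    assert (Ode := bin_series_ode z s Hz As).
    assert (HL := log_series_derive z s Hz As).
    eexists. split.
    - exact (is_Cderive_mult _ _ s _ _
        (is_Cderive_exp _ s _ (is_Cderive_mult _ _ s _ _ (is_Cderive_const (1 / 2) s) Dl))
        (is_Cderive_plus _ _ s _ _ (is_Cderive_const 1 s)
          (is_Cderive_mult _ _ s _ _ (is_Cderive_one_minus z s) Dp))).
    - fold P L in Ode, HL |- *.
      set (D := Cpseries (Cderive_coef (bin_coef z)) s) in *.
      set (D' := Cpseries (Cderive_coef (log_coef z)) s) in *.
      set (E := Cexp (1 / 2 * L s)).
      transitivity (E * (1 / 2 * (s * D') * (1 + (1 - s * z) * P s)
        - s * z * P s + s * ((1 - s * z) * D))); [ring|].
      rewrite Ode, HL.
      assert (Sq := bin_series_sqr z s Hz). fold P in Sq.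
      specialize (Sq ltac:(lra)).
      (* After both differential equations are inserted, the terms linear in [P] cancel and only
         [(1 - s z) P^2 - 1] is left. *)
      transitivity (1 / 2 * E * (((1 - s * z) * (P s * P s)) - 1)); [field|].
      rewrite Sq. ring. }
  change (f t = 2). rewrite (is_Cderive_eq_const f t).
  - unfold f, P, L. rewrite !Cpseries_0. unfold bin_coef. rewrite cbin_0. simpl.
    replace (1 / 2 * 0) with (RtoC 0) by ring. rewrite Cexp_0.
    replace (RtoC 2) with (1 + 1) by (rewrite <- RtoC_plus; f_equal; lra). ring.
  - lra.
  - intros s Hs. destruct (HD s) as [d [Hd Ed]]; [lra|].
    destruct (Ceq_dec d 0) as [E|E]; [now rewrite <- E|].
    destruct (Cmult_neq_0 (RtoC s) d) in Ed; [|exact E|exact Ed].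
    intros Es. apply RtoC_inj in Es. lra.
  - intros s Hs. destruct (HD s Hs) as [d [Hd _]]. now exists d.
Qed.

(** * The square root of [1 - t z] with positive real part *)

Definition root_branch (z : C) (t : R) : C :=
  2 * Cexp (- (1 / 2 * Cpseries (log_coef z) t)) - 1.

(** Solving [log_series_exp] for the exponential shows that [root_branch z t] equals [(1 - t z) P].
    It is expressed through the logarithmic series because that series converges at [t = 1], whereas
    [P] diverges there when [z = 1]. *)
Lemma root_branch_sqr (z : C) (t : R) : (Cmod z <= 1)%R -> (0 <= t < 1)%R ->
  root_branch z t * root_branch z t = 1 - t * z.
Proof.
  intros Hz Ht.
  assert (Sq := bin_series_sqr z t Hz Ht). assert (HE := log_series_exp z t Hz Ht).
  unfold root_branch. set (w := 1 / 2 * Cpseries (log_coef z) t) in *.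
  set (P := Cpseries (bin_coef z) t) in *.
  assert (E : 2 * Cexp (- w) - 1 = (1 - t * z) * P).
  { rewrite <- HE at 1.
    transitivity (Cexp (- w) * Cexp w * (1 + (1 - t * z) * P) - 1); [ring|].
    rewrite Cexp_opp. ring. }
  rewrite E. transitivity ((1 - t * z) * ((1 - t * z) * (P * P))); [ring|].
  rewrite Sq. ring.
Qed.

(** A purely imaginary root would make [Re (1 - t z)] nonpositive, but it is positive for [t < 1].
    So the real part has no zero on [[0, 1)], and it equals 1 at [t = 0]. *)
Lemma root_branch_Re_pos (z : C) (t : R) : (Cmod z <= 1)%R -> (0 <= t < 1)%R ->
  (0 < Re (root_branch z t))%R.
Proof.
  intros Hz Ht.
  assert (N0 : forall s, (0 <= s < 1)%R -> Re (root_branch z s) <> 0%R).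
  { intros s Hs E. assert (Sq := f_equal Re (root_branch_sqr z s Hz Hs)).
    assert (Rz := re_le_Cmod z). apply Rabs_le_between in Rz.
    destruct (root_branch z s) as [a b]. destruct z as [x y].
    simpl in *. rewrite E in Sq. nra. }
  assert (R0 : Re (root_branch z 0) = 1%R).
  { unfold root_branch. rewrite Cpseries_0. simpl log_coef.
    replace (- (1 / 2 * 0)) with (RtoC 0) by ring. rewrite Cexp_0. simpl. ring. }
  destruct (Rlt_le_dec 0 (Re (root_branch z t))) as [H|H]; [exact H|exfalso].
  assert (Hn := N0 t Ht).
  assert (Htp : (0 < t)%R).
  { destruct (Req_dec t 0) as [E|E]; [rewrite E in H; lra | lra]. }
  (* The sign is reversed so that the function goes from a negative value at 0 to a positive one at
     [t]. *)
  destruct (IVT_interv (fun s => - Re (root_branch z s))%R 0 t) as [s [Hs Es]].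
  - intros s Hs. apply continuity_pt_opp. apply continuity_pt_filterlim.
    apply (ex_derive_continuous (V := R_NormedModule)).
    assert (As : (Rabs s < 1)%R) by (apply Rabs_def1; lra).
    assert (Dl := is_Cderive_Cpseries _ _ (fun n => log_coef_bound z n Hz) As).
    eexists. unfold root_branch.
    exact (proj1 (is_Cderive_plus _ _ s _ _
      (is_Cderive_mult _ _ s _ _ (is_Cderive_const 2 s) (is_Cderive_exp _ s _
        (is_Cderive_opp _ s _
          (is_Cderive_mult _ _ s _ _ (is_Cderive_const (1 / 2) s) Dl))))
      (is_Cderive_const (- (1)) s))).
  - exact Htp.
  - rewrite R0. lra.
  - lra.
  - apply (N0 s); lra.
Qed.

(** * Limits of complex sequences, by components *)

Definition is_Clim_seq (u : nat -> C) (l : C) : Prop :=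
  is_lim_seq (fun n => Re (u n)) (Re l) /\ is_lim_seq (fun n => Im (u n)) (Im l).

Lemma is_Clim_seq_unique (u : nat -> C) (l m : C) :
  is_Clim_seq u l -> is_Clim_seq u m -> l = m.
Proof.
  intros [H1 H2] [K1 K2]. destruct l, m. f_equal.
  - apply is_lim_seq_unique in H1. apply is_lim_seq_unique in K1.
    rewrite H1 in K1. now injection K1.
  - apply is_lim_seq_unique in H2. apply is_lim_seq_unique in K2.
    rewrite H2 in K2. now injection K2.
Qed.

Lemma is_Clim_seq_const (c : C) : is_Clim_seq (fun _ => c) c.
Proof. split; apply is_lim_seq_const. Qed.

Lemma is_Clim_seq_plus (u v : nat -> C) (l m : C) :
  is_Clim_seq u l -> is_Clim_seq v m -> is_Clim_seq (fun n => u n + v n) (l + m).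
Proof. intros [H1 H2] [K1 K2]. split; now apply is_lim_seq_plus'. Qed.

Lemma is_Clim_seq_mult (u v : nat -> C) (l m : C) :
  is_Clim_seq u l -> is_Clim_seq v m -> is_Clim_seq (fun n => u n * v n) (l * m).
Proof.
  intros [H1 H2] [K1 K2].
  split; [apply is_lim_seq_minus' | apply is_lim_seq_plus']; now apply is_lim_seq_mult'.
Qed.

Lemma is_Clim_seq_opp (u : nat -> C) (l : C) :
  is_Clim_seq u l -> is_Clim_seq (fun n => - u n) (- l).
Proof.
  intros [H1 H2].
  split; [exact (proj1 (is_lim_seq_opp _ _) H1) | exact (proj1 (is_lim_seq_opp _ _) H2)].
Qed.

Lemma is_Clim_seq_exp (u : nat -> C) (l : C) :
  is_Clim_seq u l -> is_Clim_seq (fun n => Cexp (u n)) (Cexp l).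
Proof.
  intros [H1 H2].
  split; apply is_lim_seq_mult'.
  - apply (is_lim_seq_continuous exp); [|exact H1].
    apply derivable_continuous_pt, derivable_pt_exp.
  - apply (is_lim_seq_continuous cos); [apply continuity_cos | exact H2].
  - apply (is_lim_seq_continuous exp); [|exact H1].
    apply derivable_continuous_pt, derivable_pt_exp.
  - apply (is_lim_seq_continuous sin); [apply continuity_sin | exact H2].
Qed.

(** * Passage to the end point [t = 1] and the value of the logarithmic series *)

Lemma log_coef_ex_series (z : C) : (Cmod z <= 1)%R ->
  ex_series (V := C_NormedModule) (log_coef z).
Proof.
  intros Hz. apply ex_Cseries_le with (fun n => Cmod (log_coef z n)).
  - intros n. apply Rle_refl.
  - now apply log_coef_cv.
Qed.

Lemma log_series_left_1 (z : C) (t : nat -> R) : (Cmod z <= 1)%R ->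
  (forall n, (t n < 1)%R) -> is_lim_seq t 1%R ->
  is_Clim_seq (fun n => Cpseries (log_coef z) (t n)) (CSeries (log_coef z)).
Proof.
  intros Hz Ht Hl.
  destruct (is_Cseries_components _ _ (CSeries_correct _ (log_coef_ex_series z Hz)))
    as [H1 H2].
  split; simpl; apply PSeries_left_1; try assumption.
  - intros n. apply Rle_trans with (2 := log_coef_bound z n Hz), re_le_Cmod.
  - eexists. exact H1.
  - intros n. apply Rle_trans with (2 := log_coef_bound z n Hz), Im_le_Cmod.
  - eexists. exact H2.
Qed.

(** The square and the sign of the real part of [root_branch] pass to the limit [t -> 1]. Positivity
    weakens to [0 <= Re q], which still determines the principal root because [Re (1 - z) >= 0] on
    the closed disk. *)
Lemma Csqrt_log_series (z : C) : (Cmod z <= 1)%R ->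
  Csqrt (1 - z) = 2 * Cexp (- (1 / 2 * CSeries (log_coef z))) - 1.
Proof.
  intros Hz. set (q := 2 * Cexp (- (1 / 2 * CSeries (log_coef z))) - 1).
  set (t := fun n => (1 - / INR (S n))%R).
  assert (Ht : forall n, (0 <= t n < 1)%R).
  { intros n. unfold t. rewrite S_INR. assert (Hn := pos_INR n).
    assert (H := Rinv_0_lt_compat (INR n + 1) ltac:(lra)).
    assert (H' := Rinv_le_contravar 1 (INR n + 1) ltac:(lra) ltac:(lra)).
    rewrite Rinv_1 in H'. lra. }
  assert (Tl : is_lim_seq t 1%R).
  { replace 1%R with (1 - 0)%R by ring. apply is_lim_seq_minus'.
    - apply is_lim_seq_const.
    - apply (is_lim_seq_incr_1 (fun n => / INR n)%R).
      apply (is_lim_seq_inv INR p_infty); [apply is_lim_seq_INR | easy]. }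
  assert (Hq : is_Clim_seq (fun n => root_branch z (t n)) q).
  { apply is_Clim_seq_plus; [|apply is_Clim_seq_const].
    apply is_Clim_seq_mult; [apply is_Clim_seq_const|].
    apply is_Clim_seq_exp.
    apply is_Clim_seq_opp.
    apply is_Clim_seq_mult; [apply is_Clim_seq_const|].
    apply log_series_left_1; [exact Hz | apply Ht | exact Tl]. }
  assert (Rz := re_le_Cmod z). apply Rabs_le_between in Rz.
  apply Csqrt_unique.
  - apply is_Clim_seq_unique with (fun n => root_branch z (t n) * root_branch z (t n)).
    + now apply is_Clim_seq_mult.
    + assert (H : is_Clim_seq (fun n => 1 + - (RtoC (t n) * z)) (1 + - (1 * z))).
      { apply is_Clim_seq_plus; [apply is_Clim_seq_const|].
        apply is_Clim_seq_opp, is_Clim_seq_mult; [|apply is_Clim_seq_const].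
        split; [exact Tl | apply is_lim_seq_const]. }
      rewrite Cmult_1_l in H.
      split; [apply is_lim_seq_ext with (2 := proj1 H)
             | apply is_lim_seq_ext with (2 := proj2 H)];
        intros n; rewrite root_branch_sqr by auto; reflexivity.
  - apply (is_lim_seq_le (fun _ => 0%R) (fun n => Re (root_branch z (t n))) 0%R (Re q)).
    + intros n. apply Rlt_le, root_branch_Re_pos; auto.
    + apply is_lim_seq_const.
    + exact (proj1 Hq).
  - destruct z as [x y]. simpl in *. lra.
Qed.

(** With [S] the series, [1 + Csqrt (1 - z)] is [2 Cexp (- S / 2)], so the quotient is
    [Cexp (S / 2)]. Its exponent has imaginary part at most 1 in absolute value, and [PI > 3]. *)
Lemma log_series_value (z : C) : (Cmod z <= 1)%R ->
  CSeries (log_coef z) = 2 * Cln (2 / (1 + Csqrt (1 - z))).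
Proof.
  intros Hz. rewrite (Csqrt_log_series z Hz).
  assert (Hb := log_series_Im_bound z Hz). apply Rabs_le_between in Hb.
  set (S := CSeries (log_coef z)) in *.
  assert (He := Cexp_opp (1 / 2 * S)).
  assert (Hn := Cexp_neq_0 (- (1 / 2 * S))).
  replace (2 / (1 + (2 * Cexp (- (1 / 2 * S)) - 1))) with (Cexp (1 / 2 * S)).
  - rewrite Cln_Cexp; [field|].
    assert (HPI := PI2_3_2). rewrite <- RtoC_div by lra.
    destruct S as [a b]; simpl in *. lra.
  - replace (1 + (2 * Cexp (- (1 / 2 * S)) - 1)) with (2 * Cexp (- (1 / 2 * S))) by ring.
    transitivity (Cexp (- (1 / 2 * S)) * Cexp (1 / 2 * S) / Cexp (- (1 / 2 * S))).
    + field. exact Hn.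
    + rewrite He. field. exact Hn.
Qed.

(** * Summation from [k = 1] in closed form *)

Theorem theorem1 (alpha z : C)
  (Halpha : forall n : nat, (1 <= n)%nat -> alpha <> - INR n)
  (Hz : (Cmod z <= 1)%R) :
  let a := fun k : nat =>
    binom (2 * k) k * (1 / (alpha + INR k)) * (z / 4) ^ k in
  let sum_from_1 := is_series (V := C_NormedModule) (fun n => a (S n)) in
  (alpha <> 0 ->
     ex_series (V := C_NormedModule)
       (pFq_term [1 / 2; alpha] [1 + alpha] z)
     /\ sum_from_1 (1 / alpha * (pFq [1 / 2; alpha] [1 + alpha] z - 1)))
  /\ (alpha = 0 ->
     sum_from_1 (2 * Cln (2 / (1 + Csqrt (1 - z)))))
  /\ (ex_series (V := C_NormedModule)
       (pFq_term [RtoC 1; 3 / 2; 1 + alpha] [RtoC 2; 2 + alpha] z)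
     /\ sum_from_1
       (z / (2 * (1 + alpha))
        * pFq [RtoC 1; 3 / 2; 1 + alpha] [RtoC 2; 2 + alpha] z)).
Proof.
  intros a sum_from_1.
  assert (Ha : forall n, alpha <> - INR (S n)) by (intros n; apply Halpha; lia).
  assert (Hterm : forall n, a (S n) = cbin (S n) / (alpha + INR (S n)) * z ^ S n).
  { intros n. apply binom_term, Cplus_INR_neq_0, Ha. }
  assert (Hsum : forall l, is_series (V := C_NormedModule)
      (fun n => cbin (S n) / (alpha + INR (S n)) * z ^ S n) l -> sum_from_1 l).
  { intros l. apply is_Cseries_ext. intros n. symmetry. apply Hterm. }
  split; [|split].
  - intros Ha0.
    assert (Hall : forall n, alpha <> - INR n).
    { intros [|n]; [|apply Ha]. intros E. apply Ha0. rewrite E. simpl. ring. }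
    set (u := pFq_term [1 / 2; alpha] [1 + alpha] z).
    assert (Hu : ex_series (V := C_NormedModule) u).
    { destruct (cbin_series_cv alpha (fun n => z ^ S n) Ha) as [l Hl].
      { intros n. now apply Cmod_pow_le_1. }
      exists (u O + alpha * l). apply is_Cseries_decr.
      eapply is_Cseries_ext; [|exact (is_Cseries_scal alpha _ _ Hl)].
      intros n. symmetry. now apply hyp21_term. }
    split; [exact Hu|]. apply Hsum.
    assert (H := is_Cseries_incr _ _ (CSeries_correct _ Hu)).
    apply (is_Cseries_scal (1 / alpha)) in H.
    (* The constant term of the hypergeometric series is the 1 subtracted in the formula. *)
    replace (u O) with (RtoC 1) in H.
    + eapply is_Cseries_ext; [|exact H].
      intros n. cbv beta. unfold u. rewrite hyp21_term by exact Hall.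
      field. split; [apply Cplus_INR_neq_0, Ha | exact Ha0].
    + unfold u, pFq_term, Cprod. simpl. field.
  - intros E. apply Hsum. rewrite <- log_series_value by exact Hz.
    (* The term of index 0 is 0, so the sum from index 1 is the whole sum. *)
    replace (CSeries (log_coef z)) with (CSeries (log_coef z) - log_coef z 0)
      by (simpl; ring).
    eapply is_Cseries_ext;
      [|exact (is_Cseries_incr _ _ (CSeries_correct _ (log_coef_ex_series z Hz)))].
    intros n. rewrite E, Cplus_0_l. reflexivity.
  - set (u := pFq_term [RtoC 1; 3 / 2; 1 + alpha] [RtoC 2; 2 + alpha] z).
    assert (H1 : 1 + alpha <> 0).
    { rewrite Cplus_comm. apply (Cplus_INR_neq_0 alpha 1), Ha. }
    assert (Hu : ex_series (V := C_NormedModule) u).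
    { destruct (cbin_series_cv alpha (fun n => z ^ n) Ha) as [l Hl].
      { intros n. now apply Cmod_pow_le_1. }
      exists (2 * (1 + alpha) * l).
      eapply is_Cseries_ext; [|exact (is_Cseries_scal (2 * (1 + alpha)) _ _ Hl)].
      intros n. symmetry. now apply hyp32_term. }
    split; [exact Hu|]. apply Hsum.
    eapply is_Cseries_ext; [|exact (is_Cseries_scal _ _ _ (CSeries_correct _ Hu))].
    intros n. cbv beta. unfold u. rewrite hyp32_term by exact Ha.
    change (z ^ S n) with (z * z ^ n).
    field. split; [apply Cplus_INR_neq_0, Ha | exact H1].
Qed.
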